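(* For every $n\in\mathbb{N}$, the natural transformation ${}_{n}\mathsf{d}_M\colon FM\to FM\otimes M$ ($M$ ranging over commutative monoids) is a deriving transformation on the algebra modality $(F,m,u,\nabla,\eta)$ on the additive symmetric monoidal category $(\mathsf{CMon},\otimes,\mathbb{N})$.
   Context: $(\mathsf{CMon},\otimes,\mathbb{N})$ is the symmetric monoidal category of commutative monoids with the usual tensor product (universal for maps that are additive and zero-preserving in each variable), with symmetry $\sigma$, enriched over commutative monoids by pointwise addition. Associators and unitors are treated as identities. Definitions. An additive symmetric monoidal category is a symmetric monoidal category whose hom-sets are commutative monoids such that composition and $\otimes$ of morphisms preserve $+$ and $0$ in each variable. An algebra modality on a symmetric monoidal category $(\mathsf{C},\otimes,I)$ is a monad $(S,m,u)$ on $\mathsf{C}$ with natural transformations $\nabla_A\colon SA\otimes SA\to SA$, $\eta_A\colon I\to SA$ such that each $(SA,\nabla_A,\eta_A)$ is a commutative monoid in $\mathsf{C}$ and $m_A\circ\nabla_{SA}=\nabla_A\circ(m_A\otimes m_A)$. When $\mathsf{C}$ is additive symmetric monoidal, a deriving transformation on $(S,m,u,\nabla,\eta)$ is a natural transformation $\mathsf{d}_A\colon SA\to SA\otimes A$ (of morphisms in $\mathsf{C}$) satisfying: (product rule) $\mathsf{d}_A\circ\nabla_A=(\nabla_A\otimes\mathrm{id}_A)\circ(\mathrm{id}_{SA}\otimes\mathsf{d}_A)+(\nabla_A\otimes\mathrm{id}_A)\circ(\mathrm{id}_{SA}\otimes\sigma_{A,SA})\circ(\mathsf{d}_A\otimes\mathrm{id}_{SA})$;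 (linear rule) $\mathsf{d}_A\circ u_A=\eta_A\otimes\mathrm{id}_A$; (chain rule) $\mathsf{d}_A\circ m_A=(\nabla_A\otimes\mathrm{id}_A)\circ(m_A\otimes\mathsf{d}_A)\circ\mathsf{d}_{SA}$; (interchange rule) $(\mathsf{d}_A\otimes\mathrm{id}_A)\circ\mathsf{d}_A=(\mathrm{id}_{SA}\otimes\sigma_{A,A})\circ(\mathsf{d}_A\otimes\mathrm{id}_A)\circ\mathsf{d}_A$. Construction of $F$. A rig is a set $R$ with a commutative monoid $(R,+,0)$ and a monoid $(R,\cdot,1)$ such that $\cdot$ distributes over $+$ and $0\lambda=\lambda0=0$; a commutative rig with a self-map is a commutative rig $R$ with an arbitrary function $R\to R$; morphisms are rig homomorphisms commuting with the self-maps. For a commutative monoid $(M,+,0)$, let $F_0M$ be the set of formal expressions freely generated inductively by: $0$; $1$; $x_m$ for each $m\in M$; $(a+b)$ and $(ab)$ for $a,b\in F_0M$; $f(a)$ for $a\in F_0M$. Let $\sim$ be the smallest equivalence relation on $F_0M$ such that for all $a,b,c\in F_0M$ and $m,m'\in M$: $((a+b)+c)\sim(a+(b+c))$; $(a+0)\sim a$; $(a+b)\sim(b+a)$; $((ab)c)\sim(a(bc))$; $(a1)\sim a$; $(ab)\sim(ba)$; $((a+b)c)\sim((ac)+(bc))$; $(0a)\sim 0$; $x_0\sim 0$; $(x_m+x_{m'})\sim x_{m+m'}$; and $a\sim b$ implies $(a+c)\sim(b+c)$, $(ac)\sim(bc)$, $f(a)\sim f(b)$. Set $FM:=F_0M/\sim$,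 a commutative rig with $[a]+[b]=[(a+b)]$, $[a][b]=[(ab)]$, zero $[0]$, unit $[1]$, and self-map $\mathbf{f}([a])=[f(a)]$. It is the free commutative rig with a self-map on $M$, with unit $u_M\colon M\to FM$, $u_M(m)=[x_m]$. For a monoid homomorphism $\psi\colon M\to N$, $F\psi\colon FM\to FN$ is the unique morphism of commutative rigs with a self-map with $F\psi([x_m])=[x_{\psi(m)}]$. The monad multiplication $m_M\colon FFM\to FM$ is the unique morphism of commutative rigs with a self-map sending the generator of $FFM$ indexed by $[a]\in FM$ to $[a]$. Further, $\eta_M\colon\mathbb{N}\to FM$ is $\eta_M(k)=k[1]$, and $\nabla_M\colon FM\otimes FM\to FM$ is the unique monoid homomorphism with $\nabla_M([a]\otimes[b])=[a][b]$. Construction of ${}_{n}\mathsf{d}$. For $n\in\mathbb{N}$, define ${}_{n}\mathsf{d}^0_M\colon F_0M\to FM\otimes M$ by induction: ${}_{n}\mathsf{d}^0_M(0)=0$; ${}_{n}\mathsf{d}^0_M(1)=0$; ${}_{n}\mathsf{d}^0_M(x_m)=[1]\otimes m$; ${}_{n}\mathsf{d}^0_M((ab))=(\nabla_M\otimes\mathrm{id}_M)([a]\otimes{}_{n}\mathsf{d}^0_M(b))+\big((\nabla_M\otimes\mathrm{id}_M)\circ(\mathrm{id}_{FM}\otimes\sigma_{M,FM})\big)({}_{n}\mathsf{d}^0_M(a)\otimes[b])$; ${}_{n}\mathsf{d}^0_M((a+b))={}_{n}\mathsf{d}^0_M(a)+{}_{n}\mathsf{d}^0_M(b)$; ${}_{n}\mathsf{d}^0_M(f(a))=n\cdot{}_{n}\mathsf{d}^0_M(a)$.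 This is invariant under $\sim$, and ${}_{n}\mathsf{d}_M([a]):={}_{n}\mathsf{d}^0_M(a)$. *)

(* Defs.v *)
From HB Require Import structures.
From mathcomp Require Import all_boot all_algebra.
From mathcomp Require Import boolp.

Set Implicit Arguments.
Unset Strict Implicit.
Unset Printing Implicit Defensive.

Import GRing.Theory.
Local Open Scope ring_scope.
Local Open Scope quotient_scope.

Record category := Category {
  ob :> Type;
  hom : ob -> ob -> Type;
  idm : forall A, hom A A;
  compm : forall A B C, hom B C -> hom A B -> hom A C;
  compmA : forall A B C D (h : hom C D) (g : hom B C) (f : hom A B),
    compm h (compm g f) = compm (compm h g) f;
  comp1m : forall A B (f : hom A B), compm (idm B) f = f;
  compm1 : forall A B (f : hom A B), compm f (idm A) = f
}.
Arguments idm {c} A.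

Notation "g '\oc' f" := (compm g f) (at level 45, left associativity).

Record symMonCat := SymMonCat {
  smc_cat :> category;
  tens : smc_cat -> smc_cat -> smc_cat;
  tunit : smc_cat;
  tensm : forall A B C D : smc_cat,
    hom A B -> hom C D -> hom (tens A C) (tens B D);
  assoc : forall A B C, hom (tens (tens A B) C) (tens A (tens B C));
  associ : forall A B C, hom (tens A (tens B C)) (tens (tens A B) C);
  lunit : forall A, hom (tens tunit A) A;
  luniti : forall A, hom A (tens tunit A);
  runit : forall A, hom (tens A tunit) A;
  runiti : forall A, hom A (tens A tunit);
  sym : forall A B, hom (tens A B) (tens B A);
  tensm1 : forall A B, tensm (idm A) (idm B) = idm (tens A B);
  tensm_comp : forall A B C A' B' C'
      (g : hom B C) (f : hom A B) (g' : hom B' C') (f' : hom A' B'),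
    tensm (g \oc f) (g' \oc f') = tensm g g' \oc tensm f f';
  assoc_nat : forall A B C A' B' C'
      (f : hom A A') (g : hom B B') (h : hom C C'),
    assoc A' B' C' \oc tensm (tensm f g) h
      = tensm f (tensm g h) \oc assoc A B C;
  lunit_nat : forall A A' (f : hom A A'),
    lunit A' \oc tensm (idm tunit) f = f \oc lunit A;
  runit_nat : forall A A' (f : hom A A'),
    runit A' \oc tensm f (idm tunit) = f \oc runit A;
  sym_nat : forall A B A' B' (f : hom A A') (g : hom B B'),
    sym A' B' \oc tensm f g = tensm g f \oc sym A B;
  assocK : forall A B C, associ A B C \oc assoc A B C = idm _;
  associK : forall A B C, assoc A B C \oc associ A B C = idm _;
  lunitK : forall A, luniti A \oc lunit A = idm _;
  lunitiK : forall A, lunit A \oc luniti A = idm _;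
  runitK : forall A, runiti A \oc runit A = idm _;
  runitiK : forall A, runit A \oc runiti A = idm _;
  symK : forall A B, sym B A \oc sym A B = idm _;
  triangle : forall A B,
    tensm (idm A) (lunit B) \oc assoc A tunit B = tensm (runit A) (idm B);
  pentagon : forall A B C D,
    tensm (idm A) (assoc B C D) \oc assoc A (tens B C) D
        \oc tensm (assoc A B C) (idm D)
      = assoc A B (tens C D) \oc assoc (tens A B) C D;
  hexagon : forall A B C,
    assoc B C A \oc sym A (tens B C) \oc assoc A B C
      = tensm (idm B) (sym A C) \oc assoc B A C \oc tensm (sym A B) (idm C)
}.
Arguments tunit {s}.
Arguments assoc {s} A B C.
Arguments associ {s} A B C.
Arguments lunit {s} A.
Arguments luniti {s} A.
Arguments runit {s} A.
Arguments runiti {s} A.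
Arguments sym {s} A B.

Notation "A '\ox' B" := (tens A B) (at level 40, left associativity).
Notation "f '\om' g" := (tensm f g) (at level 40, left associativity).

Record addSymMonCat := AddSymMonCat {
  asmc_smc :> symMonCat;
  addm : forall A B : asmc_smc, hom A B -> hom A B -> hom A B;
  zerom : forall A B : asmc_smc, hom A B;
  addmA : forall A B, associative (@addm A B);
  addmC : forall A B, commutative (@addm A B);
  add0m : forall A B, left_id (zerom A B) (@addm A B);
  compmDl : forall A B C (g g' : hom B C) (f : hom A B),
    addm g g' \oc f = addm (g \oc f) (g' \oc f);
  compmDr : forall A B C (g : hom B C) (f f' : hom A B),
    g \oc addm f f' = addm (g \oc f) (g \oc f');
  comp0m : forall A B C (f : hom A B), zerom B C \oc f = zerom A C;
  compm0 : forall A B C (g : hom B C), g \oc zerom A B = zerom A C;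
  tensmDl : forall A B C D (f f' : hom A B) (g : hom C D),
    addm f f' \om g = addm (f \om g) (f' \om g);
  tensmDr : forall A B C D (f : hom A B) (g g' : hom C D),
    f \om addm g g' = addm (f \om g) (f \om g');
  tens0m : forall A B C D (g : hom C D), zerom A B \om g = zerom _ _;
  tensm0 : forall A B C D (f : hom A B), f \om zerom C D = zerom _ _
}.

Notation "f '\+m' g" := (addm f g) (at level 50, left associativity).

Record algebraModality (C : symMonCat) := AlgebraModality {
  am_ob :> C -> C;
  am_map : forall A B : C, hom A B -> hom (am_ob A) (am_ob B);
  am_mult : forall A : C, hom (am_ob (am_ob A)) (am_ob A);
  am_unit : forall A : C, hom A (am_ob A);
  am_nabla : forall A : C, hom (am_ob A \ox am_ob A) (am_ob A);
  am_eta : forall A : C, hom tunit (am_ob A);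
  am_map1 : forall A, am_map (idm A) = idm (am_ob A);
  am_map_comp : forall A B D (g : hom B D) (f : hom A B),
    am_map (g \oc f) = am_map g \oc am_map f;
  am_mult_nat : forall A B (f : hom A B),
    am_mult B \oc am_map (am_map f) = am_map f \oc am_mult A;
  am_unit_nat : forall A B (f : hom A B),
    am_unit B \oc f = am_map f \oc am_unit A;
  am_multA : forall A,
    am_mult A \oc am_mult (am_ob A) = am_mult A \oc am_map (am_mult A);
  am_mult_unitl : forall A, am_mult A \oc am_unit (am_ob A) = idm _;
  am_mult_unitr : forall A, am_mult A \oc am_map (am_unit A) = idm _;
  am_nabla_nat : forall A B (f : hom A B),
    am_nabla B \oc (am_map f \om am_map f) = am_map f \oc am_nabla A;
  am_eta_nat : forall A B (f : hom A B), am_map f \oc am_eta A = am_eta B;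
  am_nablaA : forall A,
    am_nabla A \oc (am_nabla A \om idm _)
      = am_nabla A \oc (idm _ \om am_nabla A) \oc assoc _ _ _;
  am_nabla1l : forall A, am_nabla A \oc (am_eta A \om idm _) = lunit _;
  am_nabla1r : forall A, am_nabla A \oc (idm _ \om am_eta A) = runit _;
  am_nablaC : forall A, am_nabla A \oc sym _ _ = am_nabla A;
  am_mult_nabla : forall A,
    am_mult A \oc am_nabla (am_ob A)
      = am_nabla A \oc (am_mult A \om am_mult A)
}.

(* Associators and unitors are not treated as identities. *)
Record deriving_transformation (C : addSymMonCat) (S : algebraModality C)
    (d : forall A : C, hom (S A) (S A \ox A)) : Prop := DerivingTransformation {
  deriving_nat : forall (A B : C) (f : hom A B),
    d B \oc am_map S f = (am_map S f \om f) \oc d A;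
  deriving_product : forall A : C,
    d A \oc am_nabla S A
      = ((am_nabla S A \om idm A) \oc associ (S A) (S A) A
           \oc (idm (S A) \om d A))
        \+m ((am_nabla S A \om idm A) \oc associ (S A) (S A) A
           \oc (idm (S A) \om sym A (S A)) \oc assoc (S A) A (S A)
           \oc (d A \om idm (S A)));
  deriving_linear : forall A : C,
    d A \oc am_unit S A = (am_eta S A \om idm A) \oc luniti A;
  deriving_chain : forall A : C,
    d A \oc am_mult S A
      = (am_nabla S A \om idm A) \oc associ (S A) (S A) A
          \oc (am_mult S A \om d A) \oc d (S A);
  deriving_interchange : forall A : C,
    (d A \om idm A) \oc d A
      = associ (S A) A A \oc (idm (S A) \om sym A A) \oc assoc (S A) A A
          \oc (d A \om idm A) \oc d A
}.

(* Commutative monoids are [nmodType]s; the choice structure they carry is no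
   restriction in the presence of the axiom of choice. *)

Lemma additive_eq (A B : nmodType) (f g : {additive A -> B}) : f =1 g -> f = g.
Proof.
case: f => f [[hf]]; case: g => g [[hg]] /= /funext fg; move: hf hg.
by rewrite /= in fg; rewrite fg => hf hg; rewrite (Prop_irrelevance hf hg).
Qed.

Record biadditive (A B C : nmodType) (h : A -> B -> C) : Prop := Biadditive {
  biadd0l : forall b, h 0 b = 0;
  biadd0r : forall a, h a 0 = 0;
  biaddDl : forall a a' b, h (a + a') b = h a b + h a' b;
  biaddDr : forall a b b', h a (b + b') = h a b + h a b'
}.

Section Tensor.
Variables A B : nmodType.

(* [tensor] below is the quotient of formal sums of pairs by the bilinearity
   relations; its universal property is [tensor_liftE], [tensor_lift_uniq]. *)
Inductive tensor_expr : Type :=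
| TZero
| TAdd of tensor_expr & tensor_expr
| TPure of A & B.

Inductive tensor_rel : tensor_expr -> tensor_expr -> Prop :=
| tr_refl s : tensor_rel s s
| tr_sym s t : tensor_rel s t -> tensor_rel t s
| tr_trans t s u : tensor_rel s t -> tensor_rel t u -> tensor_rel s u
| tr_addA s t u : tensor_rel (TAdd (TAdd s t) u) (TAdd s (TAdd t u))
| tr_addC s t : tensor_rel (TAdd s t) (TAdd t s)
| tr_add0 s : tensor_rel (TAdd s TZero) s
| tr_add s t u : tensor_rel s t -> tensor_rel (TAdd s u) (TAdd t u)
| tr_pure0l b : tensor_rel (TPure 0 b) TZero
| tr_pure0r a : tensor_rel (TPure a 0) TZero
| tr_pureDl a a' b :
    tensor_rel (TPure (a + a') b) (TAdd (TPure a b) (TPure a' b))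
| tr_pureDr a b b' :
    tensor_rel (TPure a (b + b')) (TAdd (TPure a b) (TPure a b')).

HB.instance Definition _ := gen_eqMixin tensor_expr.
HB.instance Definition _ := gen_choiceMixin tensor_expr.

Definition tensor_eqv (s t : tensor_expr) : bool := `[< tensor_rel s t >].

Lemma tensor_eqv_refl : reflexive tensor_eqv.
Proof. by move=> s; apply/asboolP; exact: tr_refl. Qed.

Lemma tensor_eqv_sym : symmetric tensor_eqv.
Proof. by move=> s t; apply/asboolP/asboolP; exact: tr_sym. Qed.

Lemma tensor_eqv_trans : transitive tensor_eqv.
Proof.
by move=> s t u /asboolP st /asboolP tu; apply/asboolP; exact: tr_trans st tu.
Qed.

Canonical tensor_equiv :=
  EquivRel tensor_eqv tensor_eqv_refl tensor_eqv_sym tensor_eqv_trans.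

Definition tensor_carrier : Type := {eq_quot tensor_eqv}.
HB.instance Definition _ := Choice.on tensor_carrier.

Definition tensor_class (s : tensor_expr) : tensor_carrier := \pi_{eq_quot tensor_eqv} s.

Lemma tensor_classP s t : tensor_class s = tensor_class t <-> tensor_rel s t.
Proof.
split=> [/eqmodP/asboolP//|st].
by apply/eqmodP/asboolP.
Qed.

Lemma tensor_class_ind (P : tensor_carrier -> Prop) :
  (forall s, P (tensor_class s)) -> forall x, P x.
Proof. by move=> H x; elim/quotW: x. Qed.

Lemma tensor_repr s : tensor_rel (repr (tensor_class s)) s.
Proof. by apply/tensor_classP; exact: reprK. Qed.

Lemma tr_addl s t u : tensor_rel s t -> tensor_rel (TAdd u s) (TAdd u t).
Proof.
move=> st; apply: tr_trans (tr_addC _ _) _.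
by apply: tr_trans (tr_addC _ _); exact: tr_add.
Qed.

Definition tensor_zero : tensor_carrier := tensor_class TZero.
Definition tensor_add (x y : tensor_carrier) : tensor_carrier :=
  tensor_class (TAdd (repr x) (repr y)).

Lemma tensor_addE s t :
  tensor_add (tensor_class s) (tensor_class t) = tensor_class (TAdd s t).
Proof.
apply/tensor_classP; apply: (@tr_trans (TAdd s (repr (tensor_class t)))).
  by apply: tr_add; exact: tensor_repr.
by apply: tr_addl; exact: tensor_repr.
Qed.

Fact tensor_addrA : associative tensor_add.
Proof.
elim/tensor_class_ind=> s; elim/tensor_class_ind=> t; elim/tensor_class_ind=> u.
rewrite !tensor_addE; apply/tensor_classP; apply: tr_sym; exact: tr_addA.
Qed.

Fact tensor_addrC : commutative tensor_add.
Proof.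
elim/tensor_class_ind=> s; elim/tensor_class_ind=> t.
rewrite !tensor_addE; apply/tensor_classP; exact: tr_addC.
Qed.

Fact tensor_add0r : left_id tensor_zero tensor_add.
Proof.
elim/tensor_class_ind=> s; rewrite tensor_addrC tensor_addE.
by apply/tensor_classP; exact: tr_add0.
Qed.

HB.instance Definition _ :=
  GRing.isNmodule.Build tensor_carrier tensor_addrA tensor_addrC tensor_add0r.

Definition tensor : nmodType := tensor_carrier.

Definition tpure (a : A) (b : B) : tensor :=
  tensor_class (TPure a b).

Lemma tpure_biadditive : biadditive tpure.
Proof.
split=> *.
- by apply/tensor_classP; exact: tr_pure0l.
- by apply/tensor_classP; exact: tr_pure0r.
- rewrite /GRing.add /= tensor_addE; apply/tensor_classP; exact: tr_pureDl.
- rewrite /GRing.add /= tensor_addE; apply/tensor_classP; exact: tr_pureDr.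
Qed.

Lemma tensor_ind (P : tensor -> Prop) :
  P 0 -> (forall x y, P x -> P y -> P (x + y)) ->
  (forall a b, P (tpure a b)) -> forall x, P x.
Proof.
move=> P0 PD Pp; elim/tensor_class_ind=> s.
elim: s => [|s IHs t IHt|a b] //; last exact: Pp.
by have := PD _ _ IHs IHt; rewrite {1}/GRing.add /= tensor_addE.
Qed.

Lemma tensor_ext (C : nmodType) (f g : {additive tensor -> C}) :
  (forall a b, f (tpure a b) = g (tpure a b)) -> f =1 g.
Proof.
move=> fg; elim/tensor_ind=> [|x y IHx IHy|]; last exact: fg.
  by rewrite !raddf0.
by rewrite !raddfD IHx IHy.
Qed.

Section Lift.
Variables (C : nmodType) (h : A -> B -> C).

Fixpoint tensor_lift_expr (s : tensor_expr) : C :=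
  match s with
  | TZero => 0
  | TAdd s t => tensor_lift_expr s + tensor_lift_expr t
  | TPure a b => h a b
  end.

Definition tensor_lift_fun (H : biadditive h) (x : tensor) : C :=
  tensor_lift_expr (repr x).

Hypothesis H : biadditive h.

Lemma tensor_lift_exprP s t :
  tensor_rel s t -> tensor_lift_expr s = tensor_lift_expr t.
Proof.
case: H => h0l h0r hDl hDr.
elim=> //= *; rewrite ?addrA ?addr0 //; first congruence; last by congr (_ + _).
by rewrite addrC.
Qed.

Lemma tensor_lift_classE s :
  tensor_lift_fun H (tensor_class s) = tensor_lift_expr s.
Proof. by apply: tensor_lift_exprP; exact: tensor_repr. Qed.

Lemma tensor_lift_nmod : nmod_morphism (tensor_lift_fun H).
Proof.
split=> [|]; first exact: tensor_lift_classE.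
elim/tensor_class_ind=> s; elim/tensor_class_ind=> t.
by rewrite [in LHS]/GRing.add /= tensor_addE !tensor_lift_classE.
Qed.

HB.instance Definition _ :=
  GRing.isNmodMorphism.Build tensor C (tensor_lift_fun H) tensor_lift_nmod.

(* [locked] only prevents unwanted unfolding during simplification. *)
Definition tensor_lift : {additive tensor -> C} :=
  locked (tensor_lift_fun H : {additive tensor -> C}).

Lemma tensor_liftE a b : tensor_lift (tpure a b) = h a b.
Proof. by rewrite /tensor_lift -lock; exact: tensor_lift_classE. Qed.

Lemma tensor_lift_uniq (f : {additive tensor -> C}) :
  (forall a b, f (tpure a b) = h a b) -> f = tensor_lift.
Proof.
move=> fh; apply: additive_eq; apply: tensor_ext => a b.
by rewrite fh tensor_liftE.
Qed.

End Lift.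
End Tensor.

Notation "a '\ot' b" := (tpure a b) (at level 40, left associativity).

Lemma tpure0l (A B : nmodType) (b : B) : (0 : A) \ot b = 0.
Proof. exact: biadd0l (tpure_biadditive A B) b. Qed.
Lemma tpure0r (A B : nmodType) (a : A) : a \ot (0 : B) = 0.
Proof. exact: biadd0r (tpure_biadditive A B) a. Qed.
Lemma tpureDl (A B : nmodType) (a a' : A) (b : B) :
  (a + a') \ot b = a \ot b + a' \ot b.
Proof. exact: biaddDl (tpure_biadditive A B) a a' b. Qed.
Lemma tpureDr (A B : nmodType) (a : A) (b b' : B) :
  a \ot (b + b') = a \ot b + a \ot b'.
Proof. exact: biaddDr (tpure_biadditive A B) a b b'. Qed.
Lemma tpureMnl (A B : nmodType) (a : A) (b : B) n : (a *+ n) \ot b = (a \ot b) *+ n.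
Proof.
by elim: n => [|n IHn]; rewrite ?mulr0n ?tpure0l // !mulrS tpureDl IHn.
Qed.
Lemma tpureMnr (A B : nmodType) (a : A) (b : B) n : a \ot (b *+ n) = (a \ot b) *+ n.
Proof.
by elim: n => [|n IHn]; rewrite ?mulr0n ?tpure0r // !mulrS tpureDr IHn.
Qed.

Definition tensorE := (tpure0l, tpure0r, tpureDl, tpureDr).

Section TensorMaps.

Lemma tmap_biadd (A B C D : nmodType) (f : {additive A -> B})
  (g : {additive C -> D}) : biadditive (fun a c => f a \ot g c).
Proof. by split=> *; rewrite ?raddf0 ?raddfD ?tensorE. Qed.

Definition tmap (A B C D : nmodType) (f : {additive A -> B})
    (g : {additive C -> D}) : {additive tensor A C -> tensor B D} :=
  tensor_lift (tmap_biadd f g).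

Lemma tsym_biadd (A B : nmodType) : biadditive (fun (a : A) (b : B) => b \ot a).
Proof. by split=> *; rewrite ?tensorE. Qed.

Definition tsym (A B : nmodType) : {additive tensor A B -> tensor B A} :=
  tensor_lift (tsym_biadd A B).

Lemma tassoc1_biadd (A B C : nmodType) (c : C) :
  biadditive (fun (a : A) (b : B) => a \ot (b \ot c)).
Proof. by split=> *; rewrite ?tensorE. Qed.

Lemma tassoc_biadd (A B C : nmodType) :
  biadditive (fun (t : tensor A B) (c : C) => tensor_lift (tassoc1_biadd A B c) t).
Proof.
split=> [c|t|t t' c|t c c']; rewrite ?raddf0 ?raddfD //.
  by elim/tensor_ind: t => [|x y IHx IHy|a b];
    rewrite ?raddf0 ?raddfD ?IHx ?IHy ?addr0 ?tensor_liftE ?tensorE.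
elim/tensor_ind: t => [|x y IHx IHy|a b];
  rewrite ?raddf0 ?addr0 ?tensor_liftE ?tensorE //.
by rewrite !raddfD IHx IHy addrACA.
Qed.

(* (a \ot b) \ot c |-> a \ot (b \ot c) *)
Definition tassoc (A B C : nmodType) :
    {additive tensor (tensor A B) C -> tensor A (tensor B C)} :=
  tensor_lift (tassoc_biadd A B C).

Lemma tassoci1_biadd (A B C : nmodType) (a : A) :
  biadditive (fun (b : B) (c : C) => (a \ot b) \ot c).
Proof. by split=> *; rewrite ?tensorE. Qed.

Lemma tassoci_biadd (A B C : nmodType) :
  biadditive (fun (a : A) (t : tensor B C) => tensor_lift (tassoci1_biadd B C a) t).
Proof.
split=> [t|a|a a' t|a t t']; rewrite ?raddf0 ?raddfD //.
  by elim/tensor_ind: t => [|x y IHx IHy|b c];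
    rewrite ?raddf0 ?raddfD ?IHx ?IHy ?addr0 ?tensor_liftE ?tensorE.
elim/tensor_ind: t => [|x y IHx IHy|b c];
  rewrite ?raddf0 ?addr0 ?tensor_liftE ?tensorE //.
by rewrite !raddfD IHx IHy addrACA.
Qed.

Definition tassoci (A B C : nmodType) :
    {additive tensor A (tensor B C) -> tensor (tensor A B) C} :=
  tensor_lift (tassoci_biadd A B C).

Lemma tlunit_biadd (A : nmodType) : biadditive (fun (k : nat) (a : A) => a *+ k).
Proof. by split=> *; rewrite ?mulr0n ?mul0rn ?mulrnDr ?mulrnDl. Qed.

Definition tlunit (A : nmodType) : {additive tensor nat A -> A} :=
  tensor_lift (tlunit_biadd A).

Lemma trunit_biadd (A : nmodType) : biadditive (fun (a : A) (k : nat) => a *+ k).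
Proof. by split=> *; rewrite ?mulr0n ?mul0rn ?mulrnDr ?mulrnDl. Qed.

Definition trunit (A : nmodType) : {additive tensor A nat -> A} :=
  tensor_lift (trunit_biadd A).

Definition tluniti_fun (A : nmodType) (a : A) : tensor nat A := 1%N \ot a.
Lemma tluniti_nmod (A : nmodType) : nmod_morphism (@tluniti_fun A).
Proof. by split=> [|a b]; rewrite /tluniti_fun tensorE. Qed.
HB.instance Definition _ (A : nmodType) :=
  GRing.isNmodMorphism.Build A (tensor nat A) (@tluniti_fun A) (tluniti_nmod A).
Definition tluniti (A : nmodType) : {additive A -> tensor nat A} := @tluniti_fun A.

Definition truniti_fun (A : nmodType) (a : A) : tensor A nat := a \ot 1%N.
Lemma truniti_nmod (A : nmodType) : nmod_morphism (@truniti_fun A).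
Proof. by split=> [|a b]; rewrite /truniti_fun tensorE. Qed.
HB.instance Definition _ (A : nmodType) :=
  GRing.isNmodMorphism.Build A (tensor A nat) (@truniti_fun A) (truniti_nmod A).
Definition truniti (A : nmodType) : {additive A -> tensor A nat} := @truniti_fun A.

Lemma tmapE (A B C D : nmodType) (f : {additive A -> B})
  (g : {additive C -> D}) a c : tmap f g (a \ot c) = f a \ot g c.
Proof. exact: tensor_liftE. Qed.
Lemma tsymE (A B : nmodType) (a : A) (b : B) : tsym A B (a \ot b) = b \ot a.
Proof. exact: tensor_liftE. Qed.
Lemma tassocE (A B C : nmodType) (a : A) (b : B) (c : C) :
  tassoc A B C (a \ot b \ot c) = a \ot (b \ot c).
Proof. by rewrite /tassoc !tensor_liftE. Qed.
Lemma tassociE (A B C : nmodType) (a : A) (b : B) (c : C) :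
  tassoci A B C (a \ot (b \ot c)) = a \ot b \ot c.
Proof. by rewrite /tassoci !tensor_liftE. Qed.
Lemma tlunitE (A : nmodType) k (a : A) : tlunit A (k \ot a) = a *+ k.
Proof. exact: tensor_liftE. Qed.
Lemma trunitE (A : nmodType) k (a : A) : trunit A (a \ot k) = a *+ k.
Proof. exact: tensor_liftE. Qed.
Lemma tlunitiE (A : nmodType) (a : A) : tluniti_fun a = 1%N \ot a.
Proof. by []. Qed.
Lemma trunitiE (A : nmodType) (a : A) : truniti_fun a = a \ot 1%N.
Proof. by []. Qed.

End TensorMaps.

Definition tmapsE :=
  (tmapE, tsymE, tassocE, tassociE, tlunitE, trunitE).


Lemma hom_ext2 (A B E : nmodType) (f g : {additive tensor A B -> E}) :
  (forall a b, f (a \ot b) = g (a \ot b)) -> f = g.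
Proof. by move=> fg; apply: additive_eq; exact: tensor_ext. Qed.

Lemma hom_ext3 (A B C E : nmodType) (f g : {additive tensor (tensor A B) C -> E}) :
  (forall a b c, f (a \ot b \ot c) = g (a \ot b \ot c)) -> f = g.
Proof.
move=> fg; apply: hom_ext2 => t c; elim/tensor_ind: t => [|x y IHx IHy|a b] //.
  by rewrite tpure0l !raddf0.
by rewrite tpureDl !raddfD IHx IHy.
Qed.

Lemma hom_ext3r (A B C E : nmodType) (f g : {additive tensor A (tensor B C) -> E}) :
  (forall a b c, f (a \ot (b \ot c)) = g (a \ot (b \ot c))) -> f = g.
Proof.
move=> fg; apply: hom_ext2 => a t; elim/tensor_ind: t => [|x y IHx IHy|b c] //.
  by rewrite tpure0r !raddf0.
by rewrite tpureDr !raddfD IHx IHy.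
Qed.

Lemma hom_ext4 (A B C D E : nmodType)
    (f g : {additive tensor (tensor (tensor A B) C) D -> E}) :
  (forall a b c d, f (a \ot b \ot c \ot d) = g (a \ot b \ot c \ot d)) -> f = g.
Proof.
move=> fg; apply: hom_ext2 => t d; elim/tensor_ind: t => [|x y IHx IHy|t c] //.
- by rewrite tpure0l !raddf0.
- by rewrite tpureDl !raddfD IHx IHy.
elim/tensor_ind: t => [|x y IHx IHy|a b] //.
- by rewrite !tpure0l !raddf0.
- by rewrite !tpureDl !raddfD IHx IHy.
Qed.

Definition ahom (A B : nmodType) : Type := {additive A -> B}.
Definition aid (A : nmodType) : ahom A A := (idfun : {additive A -> A}).
Definition acomp (A B C : nmodType) (g : ahom B C) (f : ahom A B) : ahom A C :=
  (g \o f : {additive A -> C}).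
Definition aadd (A B : nmodType) (f g : ahom A B) : ahom A B :=
  (GRing.add_fun f g : {additive A -> B}).
Definition azero (A B : nmodType) : ahom A B := (\0 : {additive A -> B}).

Definition CMon_cat : category.
Proof.
by apply: (@Category nmodType ahom aid acomp) => *; apply: additive_eq.
Defined.

Definition CMon_smc : symMonCat.
Proof.
apply: (@SymMonCat CMon_cat tensor (nat : nmodType)
  tmap tassoc tassoci tlunit tluniti trunit truniti tsym) => *.
- by apply: hom_ext2 => * /=; rewrite !tmapsE.
- by apply: hom_ext2 => * /=; rewrite !tmapsE.
- by apply: hom_ext3 => * /=; rewrite !tmapsE.
- by apply: hom_ext2 => * /=; rewrite !tmapsE raddfMn.
- by apply: hom_ext2 => * /=; rewrite !tmapsE raddfMn.
- by apply: hom_ext2 => * /=; rewrite !tmapsE.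
- by apply: hom_ext3 => * /=; rewrite !tmapsE.
- by apply: hom_ext3r => * /=; rewrite !tmapsE.
- by apply: hom_ext2 => k a /=; rewrite tlunitE tlunitiE tpureMnr -tpureMnl (natn k).
- by apply: additive_eq => a /=; rewrite tlunitiE tlunitE.
- by apply: hom_ext2 => a k /=; rewrite trunitE trunitiE tpureMnl -tpureMnr (natn k).
- by apply: additive_eq => a /=; rewrite trunitiE trunitE.
- by apply: hom_ext2 => * /=; rewrite !tmapsE.
- by apply: hom_ext3 => * /=; rewrite !tmapsE tpureMnl tpureMnr.
- by apply: hom_ext4 => * /=; rewrite !tmapsE.
- by apply: hom_ext3 => * /=; rewrite !tmapsE.
Defined.

Definition CMon : addSymMonCat.
Proof.
apply: (@AddSymMonCat CMon_smc aadd azero) => [A B f g h|A B f g|A B f|A B C g g' f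
  |A B C g f f'|A B C f|A B C g|A B C D f f' g|A B C D f g g'|A B C D g|A B C D f].
- by apply: additive_eq => x /=; rewrite /GRing.add_fun addrA.
- by apply: additive_eq => x /=; rewrite /GRing.add_fun addrC.
- by apply: additive_eq => x /=; rewrite /GRing.add_fun add0r.
- by apply: additive_eq.
- by apply: additive_eq => x /=; rewrite /GRing.add_fun raddfD.
- by apply: additive_eq.
- by apply: additive_eq => x /=; rewrite raddf0.
- by apply: hom_ext2 => x y /=; rewrite /GRing.add_fun !tmapsE /= tpureDl.
- by apply: hom_ext2 => x y /=; rewrite /GRing.add_fun !tmapsE /= tpureDr.
- by apply: hom_ext2 => x y /=; rewrite !tmapsE /= tpure0l.
- by apply: hom_ext2 => x y /=; rewrite !tmapsE /= tpure0r.
Defined.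

Section FreeRig.
Variable M : nmodType.

Inductive F0 : Type :=
| Zero
| One
| Var of M
| Add of F0 & F0
| Mul of F0 & F0
| Fapp of F0.

(* Congruence is only required on one side: the other one follows from
   [fr_addC] and [fr_mulC]. *)
Inductive F0_rel : F0 -> F0 -> Prop :=
| fr_refl a : F0_rel a a
| fr_sym a b : F0_rel a b -> F0_rel b a
| fr_trans b a c : F0_rel a b -> F0_rel b c -> F0_rel a c
| fr_addA a b c : F0_rel (Add (Add a b) c) (Add a (Add b c))
| fr_add0 a : F0_rel (Add a Zero) a
| fr_addC a b : F0_rel (Add a b) (Add b a)
| fr_mulA a b c : F0_rel (Mul (Mul a b) c) (Mul a (Mul b c))
| fr_mul1 a : F0_rel (Mul a One) a
| fr_mulC a b : F0_rel (Mul a b) (Mul b a)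
| fr_mulDl a b c : F0_rel (Mul (Add a b) c) (Add (Mul a c) (Mul b c))
| fr_mul0 a : F0_rel (Mul Zero a) Zero
| fr_var0 : F0_rel (Var 0) Zero
| fr_varD m m' : F0_rel (Add (Var m) (Var m')) (Var (m + m'))
| fr_add a b c : F0_rel a b -> F0_rel (Add a c) (Add b c)
| fr_mul a b c : F0_rel a b -> F0_rel (Mul a c) (Mul b c)
| fr_fapp a b : F0_rel a b -> F0_rel (Fapp a) (Fapp b).

HB.instance Definition _ := gen_eqMixin F0.
HB.instance Definition _ := gen_choiceMixin F0.

Definition F0_eqv (a b : F0) : bool := `[< F0_rel a b >].

Lemma F0_eqv_refl : reflexive F0_eqv.
Proof. by move=> a; apply/asboolP; exact: fr_refl. Qed.

Lemma F0_eqv_sym : symmetric F0_eqv.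
Proof. by move=> a b; apply/asboolP/asboolP; exact: fr_sym. Qed.

Lemma F0_eqv_trans : transitive F0_eqv.
Proof.
by move=> b a c /asboolP ab /asboolP bc; apply/asboolP; exact: fr_trans ab bc.
Qed.

Canonical F0_equiv := EquivRel F0_eqv F0_eqv_refl F0_eqv_sym F0_eqv_trans.

Definition F_carrier : Type := {eq_quot F0_eqv}.
HB.instance Definition _ := Choice.on F_carrier.

Definition F_class (a : F0) : F_carrier := \pi_{eq_quot F0_eqv} a.

Lemma F_classP a b : F_class a = F_class b <-> F0_rel a b.
Proof. by split=> [/eqmodP/asboolP//|ab]; apply/eqmodP/asboolP. Qed.

Lemma F_class_ind (P : F_carrier -> Prop) :
  (forall a, P (F_class a)) -> forall x, P x.
Proof. by move=> H x; elim/quotW: x. Qed.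

Lemma F_repr a : F0_rel (repr (F_class a)) a.
Proof. by apply/F_classP; exact: reprK. Qed.

Definition F_zero : F_carrier := F_class Zero.
Definition F_one : F_carrier := F_class One.
Definition F_add (x y : F_carrier) : F_carrier := F_class (Add (repr x) (repr y)).
Definition F_mul (x y : F_carrier) : F_carrier := F_class (Mul (repr x) (repr y)).
Definition F_fapp (x : F_carrier) : F_carrier := F_class (Fapp (repr x)).

Lemma F_addE a b : F_add (F_class a) (F_class b) = F_class (Add a b).
Proof.
apply/F_classP; apply: (@fr_trans (Add a (repr (F_class b)))).
  by apply: fr_add; exact: F_repr.
apply: fr_trans (fr_addC _ _) _; apply: fr_trans (fr_addC _ _).
by apply: fr_add; exact: F_repr.
Qed.

Lemma F_mulE a b : F_mul (F_class a) (F_class b) = F_class (Mul a b).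
Proof.
apply/F_classP; apply: (@fr_trans (Mul a (repr (F_class b)))).
  by apply: fr_mul; exact: F_repr.
apply: fr_trans (fr_mulC _ _) _; apply: fr_trans (fr_mulC _ _).
by apply: fr_mul; exact: F_repr.
Qed.

Lemma F_fappE a : F_fapp (F_class a) = F_class (Fapp a).
Proof. by apply/F_classP; apply: fr_fapp; exact: F_repr. Qed.

Fact F_addrA : associative F_add.
Proof.
elim/F_class_ind=> a; elim/F_class_ind=> b; elim/F_class_ind=> c.
by rewrite !F_addE; apply/F_classP/fr_sym/fr_addA.
Qed.

Fact F_addrC : commutative F_add.
Proof.
elim/F_class_ind=> a; elim/F_class_ind=> b.
by rewrite !F_addE; apply/F_classP/fr_addC.
Qed.

Fact F_add0r : left_id F_zero F_add.
Proof.
elim/F_class_ind=> a.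
by rewrite F_addrC F_addE; apply/F_classP/fr_add0.
Qed.

HB.instance Definition _ :=
  GRing.isNmodule.Build F_carrier F_addrA F_addrC F_add0r.

Fact F_mulrA : associative F_mul.
Proof.
elim/F_class_ind=> a; elim/F_class_ind=> b; elim/F_class_ind=> c.
by rewrite !F_mulE; apply/F_classP/fr_sym/fr_mulA.
Qed.

Fact F_mulrC : commutative F_mul.
Proof.
elim/F_class_ind=> a; elim/F_class_ind=> b.
by rewrite !F_mulE; apply/F_classP/fr_mulC.
Qed.

Fact F_mul1r : left_id F_one F_mul.
Proof.
elim/F_class_ind=> a.
by rewrite F_mulrC F_mulE; apply/F_classP/fr_mul1.
Qed.

Fact F_mulrDl : left_distributive F_mul (@GRing.add F_carrier).
Proof.
elim/F_class_ind=> a; elim/F_class_ind=> b; elim/F_class_ind=> c.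
rewrite /GRing.add /= F_addE !F_mulE F_addE; apply/F_classP; exact: fr_mulDl.
Qed.

Fact F_mul0r : left_zero (0 : F_carrier) F_mul.
Proof.
elim/F_class_ind=> a.
by rewrite /GRing.zero /= F_mulE; apply/F_classP; exact: fr_mul0.
Qed.

HB.instance Definition _ := GRing.Nmodule_isComPzSemiRing.Build F_carrier
  F_mulrA F_mulrC F_mul1r F_mulrDl F_mul0r.

Definition F : comPzSemiRingType := F_carrier.

Definition cls (a : F0) : F := F_class a.

Definition selfmap (x : F) : F := F_fapp x.

Lemma clsP a b : cls a = cls b <-> F0_rel a b.
Proof. exact: F_classP. Qed.

Lemma cls_surj (x : F) : exists a, x = cls a.
Proof. by elim/F_class_ind: x => a; exists a. Qed.

Lemma cls0 : cls Zero = 0. Proof. by []. Qed.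
Lemma cls1 : cls One = 1. Proof. by []. Qed.
Lemma clsD a b : cls (Add a b) = cls a + cls b.
Proof. by rewrite /cls -F_addE. Qed.
Lemma clsM a b : cls (Mul a b) = cls a * cls b.
Proof. by rewrite /cls -F_mulE. Qed.
Lemma cls_fapp a : cls (Fapp a) = selfmap (cls a).
Proof. by rewrite /selfmap /cls F_fappE. Qed.

Definition F_gen (m : M) : F := cls (Var m).

Lemma F_gen_nmod : nmod_morphism F_gen.
Proof.
split=> [|m m']; first by rewrite -cls0; apply/clsP/fr_var0.
by rewrite /F_gen -clsD; apply/clsP/fr_sym/fr_varD.
Qed.

HB.instance Definition _ := GRing.isNmodMorphism.Build M F F_gen F_gen_nmod.

Definition F_unit : {additive M -> F} := F_gen.

Definition clsE := (cls0, cls1, clsD, clsM, cls_fapp).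

Lemma F_ind (P : F -> Prop) :
  P 0 -> P 1 -> (forall m, P (F_unit m)) ->
  (forall x y, P x -> P y -> P (x + y)) ->
  (forall x y, P x -> P y -> P (x * y)) ->
  (forall x, P x -> P (selfmap x)) -> forall x, P x.
Proof.
move=> P0 P1 PV PD PM Pf x; have [a ->] := cls_surj x.
by elim: a => [||m|a IHa b IHb|a IHa b IHb|a IHa]; rewrite ?clsE; auto;
  exact: PV.
Qed.

(* The universal property: a commutative rig [R] with self-map [phi] and an
   additive map [g : M -> R] determine a unique morphism of commutative rigs
   with a self-map [F -> R] extending [g]. *)
Section Extension.
Variables (R : comPzSemiRingType) (phi : R -> R) (g : {additive M -> R}).

Fixpoint F_ext0 (a : F0) : R :=
  match a with
  | Zero => 0
  | One => 1
  | Var m => g m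
  | Add a b => F_ext0 a + F_ext0 b
  | Mul a b => F_ext0 a * F_ext0 b
  | Fapp a => phi (F_ext0 a)
  end.

Lemma F_ext0P a b : F0_rel a b -> F_ext0 a = F_ext0 b.
Proof.
elim=> //=.
- by move=> {}b {}a c _ -> _ ->.
- by move=> *; rewrite addrA.
- by move=> *; rewrite addr0.
- by move=> *; rewrite addrC.
- by move=> *; rewrite mulrA.
- by move=> *; rewrite mulr1.
- by move=> *; rewrite mulrC.
- by move=> *; rewrite mulrDl.
- by move=> *; rewrite mul0r.
- by rewrite raddf0.
- by move=> *; rewrite raddfD.
- by move=> {}a {}b c _ ->.
- by move=> {}a {}b c _ ->.
- by move=> {}a {}b _ ->.
Qed.

Definition F_ext_fun (x : F) : R := F_ext0 (repr (x : F_carrier)).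

Lemma F_ext_cls a : F_ext_fun (cls a) = F_ext0 a.
Proof. by apply: F_ext0P; exact: F_repr. Qed.

Lemma F_ext_nmod : nmod_morphism F_ext_fun.
Proof.
split=> [|x y]; first by rewrite -cls0 F_ext_cls.
have [a ->] := cls_surj x; have [b ->] := cls_surj y.
by rewrite -clsD !F_ext_cls.
Qed.

Lemma F_ext_monoid : monoid_morphism F_ext_fun.
Proof.
split=> [|x y]; first by rewrite -cls1 F_ext_cls.
have [a ->] := cls_surj x; have [b ->] := cls_surj y.
by rewrite -clsM !F_ext_cls.
Qed.

HB.instance Definition _ := GRing.isNmodMorphism.Build F R F_ext_fun F_ext_nmod.
HB.instance Definition _ :=
  GRing.isMonoidMorphism.Build F R F_ext_fun F_ext_monoid.

Definition F_ext : {rmorphism F -> R} :=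
  locked (F_ext_fun : {rmorphism F -> R}).

Lemma F_ext_unit m : F_ext (F_unit m) = g m.
Proof. by rewrite /F_ext -lock; exact: F_ext_cls. Qed.

Lemma F_ext_selfmap x : F_ext (selfmap x) = phi (F_ext x).
Proof.
rewrite /F_ext -lock; have [a ->] := cls_surj x.
by rewrite -cls_fapp /= !F_ext_cls.
Qed.

Lemma F_ext_uniq (h : {rmorphism F -> R}) :
  (forall m, h (F_unit m) = g m) -> (forall x, h (selfmap x) = phi (h x)) ->
  h =1 F_ext.
Proof.
move=> hg hf; elim/F_ind=> [||m|x y IHx IHy|x y IHx IHy|x IHx].
- by rewrite !rmorph0.
- by rewrite !rmorph1.
- by rewrite hg F_ext_unit.
- by rewrite !rmorphD IHx IHy.
- by rewrite !rmorphM IHx IHy.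
- by rewrite hf F_ext_selfmap IHx.
Qed.

End Extension.
End FreeRig.

Arguments Zero {M}.
Arguments One {M}.

Definition F_map (M N : nmodType) (psi : {additive M -> N}) :
    {rmorphism F M -> F N} :=
  F_ext (@selfmap N) (F_unit N \o psi : {additive M -> F N}).

Definition F_mult (M : nmodType) : {rmorphism F (F M) -> F M} :=
  F_ext (@selfmap M) (idfun : {additive F M -> F M}).

Lemma F_map_unit (M N : nmodType) (psi : {additive M -> N}) m :
  F_map psi (F_unit M m) = F_unit N (psi m).
Proof. exact: F_ext_unit. Qed.
Lemma F_map_selfmap (M N : nmodType) (psi : {additive M -> N}) x :
  F_map psi (selfmap x) = selfmap (F_map psi x).
Proof. exact: F_ext_selfmap. Qed.
Lemma F_mult_unit (M : nmodType) x : F_mult M (F_unit (F M) x) = x.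
Proof. exact: F_ext_unit. Qed.
Lemma F_mult_selfmap (M : nmodType) x : F_mult M (selfmap x) = selfmap (F_mult M x).
Proof. exact: F_ext_selfmap. Qed.

Definition F_eta_fun (M : nmodType) (k : nat) : F M := 1 *+ k.
Lemma F_eta_nmod (M : nmodType) : nmod_morphism (@F_eta_fun M).
Proof. by split=> [|k l]; rewrite /F_eta_fun ?mulr0n // mulrnDr. Qed.
HB.instance Definition _ (M : nmodType) :=
  GRing.isNmodMorphism.Build nat (F M) (@F_eta_fun M) (F_eta_nmod M).
Definition F_eta (M : nmodType) : {additive nat -> F M} := @F_eta_fun M.

Lemma F_nabla_biadd (M : nmodType) : biadditive (fun x y : F M => x * y).
Proof. by split=> *; rewrite ?mul0r ?mulr0 ?mulrDl ?mulrDr. Qed.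
Definition F_nabla (M : nmodType) : {additive tensor (F M) (F M) -> F M} :=
  tensor_lift (F_nabla_biadd M).
Lemma F_nablaE (M : nmodType) (x y : F M) : F_nabla M (x \ot y) = x * y.
Proof. exact: tensor_liftE. Qed.

Definition F_obj (M : nmodType) : nmodType := F M.
Definition F_map_hom (M N : nmodType) (psi : {additive M -> N}) :
  {additive F_obj M -> F_obj N} := F_map psi.
Definition F_mult_hom (M : nmodType) : {additive F_obj (F_obj M) -> F_obj M} :=
  F_mult M.

Definition F_modality : algebraModality CMon.
Proof.
apply: (@AlgebraModality CMon F_obj F_map_hom F_mult_hom F_unit F_nabla F_eta)
  => *.
- apply: additive_eq => /=; elim/F_ind => /= [||m|x y IHx IHy|x y IHx IHy|x IHx].
  + by rewrite rmorph0.
  + by rewrite rmorph1.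
  + by rewrite F_map_unit.
  + by rewrite rmorphD IHx IHy.
  + by rewrite rmorphM IHx IHy.
  + by rewrite F_map_selfmap IHx.
- apply: additive_eq => /=; elim/F_ind => /= [||m|x y IHx IHy|x y IHx IHy|x IHx].
  + by rewrite !rmorph0.
  + by rewrite !rmorph1.
  + by rewrite !F_map_unit.
  + by rewrite !rmorphD IHx IHy.
  + by rewrite !rmorphM IHx IHy.
  + by rewrite !F_map_selfmap IHx.
- apply: additive_eq => /=; elim/F_ind => /= [||m|x y IHx IHy|x y IHx IHy|x IHx].
  + by rewrite !rmorph0.
  + by rewrite !rmorph1.
  + by rewrite F_map_unit !F_mult_unit.
  + by rewrite !rmorphD IHx IHy.
  + by rewrite !rmorphM IHx IHy.
  + by rewrite F_map_selfmap !F_mult_selfmap F_map_selfmap IHx.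
- by apply: additive_eq => x /=; rewrite F_map_unit.
- apply: additive_eq => /=; elim/F_ind => /= [||m|x y IHx IHy|x y IHx IHy|x IHx].
  + by rewrite !rmorph0.
  + by rewrite !rmorph1.
  + by rewrite F_map_unit !F_mult_unit.
  + by rewrite !rmorphD IHx IHy.
  + by rewrite !rmorphM IHx IHy.
  + by rewrite F_map_selfmap !F_mult_selfmap IHx.
- by apply: additive_eq => x /=; rewrite F_mult_unit.
- apply: additive_eq => /=; elim/F_ind => /= [||m|x y IHx IHy|x y IHx IHy|x IHx].
  + by rewrite !rmorph0.
  + by rewrite !rmorph1.
  + by rewrite F_map_unit F_mult_unit.
  + by rewrite !rmorphD IHx IHy.
  + by rewrite !rmorphM IHx IHy.
  + by rewrite F_map_selfmap F_mult_selfmap IHx.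
- by apply: hom_ext2 => x y /=; rewrite tmapsE !F_nablaE /= rmorphM.
- by apply: additive_eq => k /=; rewrite /F_eta_fun rmorphMn rmorph1.
- by apply: hom_ext3 => x y z /=; rewrite !tmapsE !F_nablaE mulrA.
- apply: hom_ext2 => k x /=.
  by rewrite !tmapsE F_nablaE /= /F_eta_fun mulr_natl.
- apply: hom_ext2 => x k /=.
  by rewrite !tmapsE F_nablaE /= /F_eta_fun mulr_natr.
- by apply: hom_ext2 => x y /=; rewrite !tmapsE !F_nablaE mulrC.
- by apply: hom_ext2 => x y /=; rewrite !tmapsE !F_nablaE /= rmorphM.
Defined.

Section Nd.
Variables (n : nat) (M : nmodType).

Fixpoint nd0 (a : F0 M) : tensor (F M) M :=
  match a with
  | Zero => 0
  | One => 0
  | Var m => 1 \ot m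
  | Add a b => nd0 a + nd0 b
  | Mul a b =>
      tmap (F_nabla M) idfun (tassoci (F M) (F M) M (cls a \ot nd0 b))
      + tmap (F_nabla M) idfun (tassoci (F M) (F M) M
          (tmap idfun (tsym M (F M)) (tassoc (F M) M (F M) (nd0 a \ot cls b))))
  | Fapp a => nd0 a *+ n
  end.

Let act (x : F M) (t : tensor (F M) M) : tensor (F M) M :=
  tmap (F_nabla M) idfun (tassoci (F M) (F M) M (x \ot t)).

Let act_pure x y m : act x (y \ot m) = (x * y) \ot m.
Proof. by rewrite /act !tmapsE F_nablaE. Qed.

Let act0r x : act x 0 = 0.
Proof. by rewrite /act tpure0r !raddf0. Qed.

Let act0l t : act 0 t = 0.
Proof. by rewrite /act tpure0l !raddf0. Qed.

Let actDr x t u : act x (t + u) = act x t + act x u.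
Proof. by rewrite /act tpureDr !raddfD. Qed.

Let actDl x y t : act (x + y) t = act x t + act y t.
Proof. by rewrite /act tpureDl !raddfD. Qed.

Let act1 t : act 1 t = t.
Proof.
elim/tensor_ind: t => [|t u IHt IHu|x m]; rewrite ?act0r ?actDr ?IHt ?IHu //.
by rewrite act_pure mul1r.
Qed.

Let actA x y t : act (x * y) t = act x (act y t).
Proof.
elim/tensor_ind: t => [|t u IHt IHu|z m]; rewrite ?act0r ?actDr ?IHt ?IHu //.
by rewrite !act_pure mulrA.
Qed.

Let nd0_mulE a b : nd0 (Mul a b) = act (cls a) (nd0 b) + act (cls b) (nd0 a).
Proof.
rewrite /=; congr (_ + _).
elim/tensor_ind: (nd0 a) => [|t u IHt IHu|z m].
- by rewrite tpure0l !raddf0 act0r.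
- by rewrite tpureDl !raddfD IHt IHu actDr.
- by rewrite act_pure !tmapsE F_nablaE mulrC.
Qed.

Lemma nd0P a b : F0_rel a b -> nd0 a = nd0 b.
Proof.
elim=> [{}a|{}a {}b _ ->|{}b {}a c _ -> _ ->|{}a {}b c|{}a|{}a {}b|{}a {}b c|{}a
  |{}a {}b|{}a {}b c|{}a||m m'|{}a {}b c _ IH|{}a {}b c ab IH|{}a {}b _ IH] //;
  rewrite ?nd0_mulE.
- by rewrite /= addrA.
- by rewrite /= addr0.
- by rewrite /= addrC.
- rewrite !clsM !actDr -!actA -!addrA; congr (_ + (_ + _)).
    by rewrite [cls c * _]mulrC.
  by rewrite mulrC.
- by rewrite act0r add0r cls1 act1.
- by rewrite addrC.
- have addE u v : nd0 (Add u v) = nd0 u + nd0 v by [].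
  by rewrite !addE !nd0_mulE clsD actDl actDr addrACA.
- by rewrite cls0 act0l act0r addr0.
- by rewrite /= tpure0r.
- by rewrite /= tpureDr.
- by rewrite /= IH.
- by rewrite IH; congr (act _ _ + _); apply/clsP.
- by rewrite /= IH.
Qed.

Definition nd_fun (x : F M) : tensor (F M) M := nd0 (repr (x : F_carrier M)).

Lemma nd_funE a : nd_fun (cls a) = nd0 a.
Proof. by apply: nd0P; exact: F_repr. Qed.

Lemma nd_nmod : nmod_morphism nd_fun.
Proof.
split=> [|x y]; first by rewrite -cls0 nd_funE.
have [a ->] := cls_surj x; have [b ->] := cls_surj y.
by rewrite -clsD !nd_funE.
Qed.

HB.instance Definition _ :=
  GRing.isNmodMorphism.Build (F M) (tensor (F M) M) nd_fun nd_nmod.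

Definition nd : {additive F M -> tensor (F M) M} := nd_fun.

Lemma ndE a : nd (cls a) = nd0 a.
Proof. exact: nd_funE. Qed.

End Nd.

(* Main.v *)
Require Import Defs.
From mathcomp Require Import all_boot all_algebra.

Set Implicit Arguments.
Unset Strict Implicit.
Unset Printing Implicit Defensive.

Import GRing.Theory.
Local Open Scope ring_scope.

(** Every map in sight is additive, so an equation between maps out of a
    tensor product may be checked on pure tensors, and an equation between maps
    out of [F M] by induction on rig expressions with a self-map ([F_ind]).
    For the latter one has to know how each side behaves on products.  The
    bookkeeping device is the [F M]-module structure [lact] of the tensor
    product of [F M] and [M], written with a dot below: in these terms the
    clause for products in the construction of [nd] is the Leibniz rule [ndM],
      [nd (x y) = x . nd y + y . nd x].

    The product and linear rules are this Leibniz rule and the value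
    [nd (F_unit m) = 1 \ot m].  For naturality and the chain rule, both sides
    satisfy the same Leibniz rule along a rig morphism, [F_map f] or
    [F_mult M] ([tmap_F_map_lact], [chain_map_lact]); they agree on generators,
    and both turn the self-map into multiplication by [n], because [F_map f]
    and [F_mult M] commute with self-maps while additive maps commute with
    multiplication by [n].

    Only the interchange rule involves the second derivative
    [dd x = tmap nd idfun (nd x)].  It vanishes on generators and is multiplied
    by [n * n] under the self-map.  Differentiating the Leibniz rule gives
      [dd (x y) = x . dd y + J (nd x) (nd y) + y . dd x + J (nd y) (nd x)],
    where [J = cross] multiplies the coefficients of two elements and keeps
    their two linear parts side by side ([tmap_nd_lact]).  Exchanging the linear
    parts commutes with the action ([exchange_lact]) and swaps the arguments of
    [J] ([exchange_cross]), so it permutes the mixed terms, and the symmetry of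
    second derivatives propagates through products. *)

Section TensorAction.
Variable R : comPzSemiRingType.

Definition lact (M : nmodType) (x : R) : {additive tensor R M -> tensor R M} :=
  tmap (x \*o idfun : {additive R -> R}) idfun.

Lemma lactE (M : nmodType) (x y : R) (m : M) : lact M x (y \ot m) = (x * y) \ot m.
Proof. exact: tmapE. Qed.

Lemma lactM (M : nmodType) x y (t : tensor R M) :
  lact M (x * y) t = lact M x (lact M y t).
Proof.
elim/tensor_ind: t => [|t u IHt IHu|z m]; first by rewrite !raddf0.
  by rewrite !raddfD IHt IHu.
by rewrite !lactE mulrA.
Qed.

Lemma lact1 (M : nmodType) (t : tensor R M) : lact M 1 t = t.
Proof.
elim/tensor_ind: t => [|t u IHt IHu|z m]; first by rewrite raddf0.
  by rewrite raddfD IHt IHu.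
by rewrite lactE mul1r.
Qed.

Lemma lactDl (M : nmodType) x y (t : tensor R M) :
  lact M (x + y) t = lact M x t + lact M y t.
Proof.
elim/tensor_ind: t => [|t u IHt IHu|z m]; first by rewrite !raddf0 addr0.
  by rewrite !raddfD IHt IHu addrACA.
by rewrite !lactE mulrDl tpureDl.
Qed.

Lemma lact0l (M : nmodType) (t : tensor R M) : lact M 0 t = 0.
Proof.
elim/tensor_ind: t => [|t u IHt IHu|z m]; first by rewrite !raddf0.
  by rewrite !raddfD IHt IHu addr0.
by rewrite !lactE mul0r tpure0l.
Qed.

Lemma cross_biadd (M N : nmodType) (s : tensor R M) :
  biadditive (fun (y : R) (b : N) => lact M y s \ot b).
Proof. by split=> *; rewrite ?lact0l ?lactDl ?tensorE. Qed.

(** The pairing [(x \ot a, y \ot b) |-> (x * y) \ot a \ot b], which multiplies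
    two one-variable differentials into a mixed second-order term. *)
Definition cross (M N : nmodType) (s : tensor R M) :
    {additive tensor R N -> tensor (tensor R M) N} :=
  tensor_lift (cross_biadd N s).

Lemma crossE (M N : nmodType) (s : tensor R M) y (b : N) :
  cross N s (y \ot b) = lact M y s \ot b.
Proof. exact: tensor_liftE. Qed.

Lemma cross0l (M N : nmodType) (t : tensor R N) : cross N (0 : tensor R M) t = 0.
Proof.
elim/tensor_ind: t => [|t u IHt IHu|y b]; first by rewrite raddf0.
  by rewrite raddfD IHt IHu addr0.
by rewrite crossE raddf0 tpure0l.
Qed.

Lemma crossDl (M N : nmodType) (s s' : tensor R M) (t : tensor R N) :
  cross N (s + s') t = cross N s t + cross N s' t.
Proof.
elim/tensor_ind: t => [|t u IHt IHu|y b]; first by rewrite !raddf0 addr0.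
  by rewrite !raddfD IHt IHu addrACA.
by rewrite !crossE raddfD tpureDl.
Qed.

Definition exchange (M N : nmodType) :
    {additive tensor (tensor R M) N -> tensor (tensor R N) M} :=
  tassoci R N M \o (tmap idfun (tsym M N) \o tassoc R M N).

Lemma exchangeE (M N : nmodType) (x : R) (a : M) (b : N) :
  exchange M N (x \ot a \ot b) = x \ot b \ot a.
Proof. by rewrite /exchange /= !tmapsE. Qed.

Lemma exchange_lact (M N : nmodType) x (w : tensor (tensor R M) N) :
  exchange M N (tmap (lact M x) idfun w)
    = tmap (lact N x) idfun (exchange M N w).
Proof.
have E : exchange M N \o tmap (lact M x) idfun
    = tmap (lact N x) idfun \o exchange M N :> {additive _ -> _}.
  by apply: hom_ext3 => y a b; rewrite /= !(tmapsE, lactE).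
exact: (congr1 (fun f : {additive _ -> _} => f w) E).
Qed.

(** Multiplication in [R] is commutative, so only the order of the linear
    parts records which argument of [cross] came first. *)
Lemma exchange_cross (M N : nmodType) (s : tensor R M) (t : tensor R N) :
  exchange M N (cross N s t) = cross M t s.
Proof.
elim/tensor_ind: t => [|t u IHt IHu|y b].
- by rewrite cross0l !raddf0.
- by rewrite crossDl !raddfD IHt IHu.
elim/tensor_ind: s => [|s u IHs IHu|x a].
- by rewrite cross0l !raddf0.
- by rewrite crossDl !raddfD IHs IHu.
by rewrite !crossE !lactE exchangeE mulrC.
Qed.

End TensorAction.

Lemma nabla_lact (M N : nmodType) (x : F M) (t : tensor (F M) N) :
  tmap (F_nabla M) idfun (tassoci (F M) (F M) N (x \ot t)) = lact N x t.
Proof.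
elim/tensor_ind: t => [|t u IHt IHu|y m]; first by rewrite tpure0r !raddf0.
  by rewrite tpureDr !raddfD IHt IHu.
by rewrite lactE !tmapsE F_nablaE.
Qed.

Lemma nabla_sym_lact (M N : nmodType) (t : tensor (F M) N) (x : F M) :
  tmap (F_nabla M) idfun (tassoci (F M) (F M) N
    (tmap idfun (tsym N (F M)) (tassoc (F M) N (F M) (t \ot x)))) = lact N x t.
Proof.
elim/tensor_ind: t => [|t u IHt IHu|y m]; first by rewrite tpure0l !raddf0.
  by rewrite tpureDl !raddfD IHt IHu.
by rewrite lactE !tmapsE F_nablaE mulrC.
Qed.

Section Derivation.
Variables (n : nat) (M : nmodType).

Lemma nd_unit m : nd n M (F_unit M m) = 1 \ot m.
Proof. exact: ndE. Qed.

Lemma nd1 : nd n M 1 = 0.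
Proof. exact: (ndE n One). Qed.

Lemma ndM x y : nd n M (x * y) = lact M x (nd n M y) + lact M y (nd n M x).
Proof.
have [a ->] := cls_surj x; have [b ->] := cls_surj y.
by rewrite -clsM !ndE /= nabla_lact nabla_sym_lact.
Qed.

Lemma nd_selfmap x : nd n M (selfmap x) = nd n M x *+ n.
Proof. by have [a ->] := cls_surj x; rewrite -cls_fapp !ndE. Qed.

(** The Leibniz rule applied to the coefficients of an element of
    [tensor (F M) M]; the second summand is where the mixed terms of a second
    derivative come from. *)
Lemma tmap_nd_lact x (t : tensor (F M) M) :
  tmap (nd n M) idfun (lact M x t)
    = tmap (lact M x) idfun (tmap (nd n M) idfun t) + cross M (nd n M x) t.
Proof.
elim/tensor_ind: t => [|t u IHt IHu|y m]; first by rewrite !raddf0 addr0.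
  by rewrite !raddfD IHt IHu addrACA.
by rewrite lactE !tmapE ndM crossE tpureDl.
Qed.

Lemma nd_interchange x :
  exchange (F M) M M (tmap (nd n M) idfun (nd n M x))
    = tmap (nd n M) idfun (nd n M x).
Proof.
elim/F_ind: x => [||m|x y IHx IHy|x y IHx IHy|x IHx].
- by rewrite !raddf0.
- by rewrite nd1 !raddf0.
- by rewrite nd_unit tmapE nd1 tpure0l raddf0.
- by rewrite !raddfD IHx IHy.
- rewrite ndM !raddfD !tmap_nd_lact !raddfD !exchange_lact !exchange_cross.
  (* The two mixed terms have been exchanged with each other. *)
  by rewrite IHx IHy addrACA [X in _ + X]addrC addrACA.
- by rewrite nd_selfmap !raddfMn IHx.
Qed.

End Derivation.

Lemma tmap_F_map_lact (M N : nmodType) (f : {additive M -> N}) x t :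
  tmap (F_map f) f (lact M x t) = lact N (F_map f x) (tmap (F_map f) f t).
Proof.
elim/tensor_ind: t => [|t u IHt IHu|y m]; first by rewrite !raddf0.
  by rewrite !raddfD IHt IHu.
by rewrite lactE !tmapE /= rmorphM.
Qed.

Lemma nd_natural n (M N : nmodType) (f : {additive M -> N}) x :
  nd n N (F_map f x) = tmap (F_map f) f (nd n M x).
Proof.
elim/F_ind: x => [||m|x y IHx IHy|x y IHx IHy|x IHx].
- by rewrite !raddf0.
- by rewrite rmorph1 !nd1 raddf0.
- by rewrite F_map_unit !nd_unit tmapE /= rmorph1.
- by rewrite !raddfD IHx IHy.
- by rewrite rmorphM !ndM IHx IHy raddfD !tmap_F_map_lact.
- by rewrite F_map_selfmap !nd_selfmap IHx raddfMn.
Qed.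

(** The right-hand side of the chain rule with its innermost derivative
    removed: [X \ot y |-> lact M (F_mult M X) (nd n M y)]. *)
Definition chain_map n (M : nmodType) :
    {additive tensor (F (F M)) (F M) -> tensor (F M) M} :=
  tmap (F_nabla M) idfun \o
    (tassoci (F M) (F M) M \o tmap (F_mult M) (nd n M)).

Lemma chain_mapE n (M : nmodType) X y :
  chain_map n M (X \ot y) = lact M (F_mult M X) (nd n M y).
Proof. by rewrite /chain_map /= tmapE nabla_lact. Qed.

Lemma chain_map_lact n (M : nmodType) X t :
  chain_map n M (lact (F M) X t) = lact M (F_mult M X) (chain_map n M t).
Proof.
elim/tensor_ind: t => [|t u IHt IHu|Y z]; first by rewrite !raddf0.
  by rewrite !raddfD IHt IHu.
by rewrite lactE !chain_mapE rmorphM lactM.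
Qed.

Lemma nd_chain n (M : nmodType) X :
  nd n M (F_mult M X) = chain_map n M (nd n (F M) X).
Proof.
elim/F_ind: X => [||x|X Y IHX IHY|X Y IHX IHY|X IHX].
- by rewrite !raddf0.
- by rewrite rmorph1 !nd1 raddf0.
- by rewrite F_mult_unit nd_unit chain_mapE rmorph1 lact1.
- by rewrite !raddfD IHX IHY.
- by rewrite rmorphM !ndM IHX IHY raddfD !chain_map_lact.
- by rewrite F_mult_selfmap !nd_selfmap IHX raddfMn.
Qed.

Theorem proposition6p14 (n : nat) :
  @deriving_transformation CMon F_modality (nd n).
Proof.
split.
- by move=> M N f; apply: additive_eq => x; exact: nd_natural.
- move=> M; apply: hom_ext2 => x y /=.
  rewrite F_nablaE ndM /GRing.add_fun /= !tmapE /=.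
  by rewrite nabla_lact nabla_sym_lact.
- move=> M; apply: additive_eq => m.
  by rewrite /= nd_unit tlunitiE tmapE /= /F_eta_fun mulr1n.
- by move=> M; apply: additive_eq => X; exact: nd_chain.
- by move=> M; apply: additive_eq => x; exact/esym/nd_interchange.
Qed.
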